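(* Let $k\ge 3$ and $n$ be odd positive integers such that $k\mid\sigma(n)$. Let $A'_1,A'_2,\dots,A'_{\frac{k-1}{2}}$ be pairwise disjoint subsets of the set of all positive divisors of $n$ such that the elements of $A'_i$ sum to $\frac{2\sigma(n)}{k}$ for every integer $1\le i\le \frac{k-1}{2}$. Let $\alpha$ be a positive integer and put $A''_i=\{2^{\alpha}d : d\in A'_i\}$ for every integer $1\le i\le\frac{k-1}{2}$. Suppose that $m=2^{\alpha}n$ is a $k$-layered number with a $k$-layered partition $\{A_1,A_2,\dots,A_k\}$ such that $A''_i\subset A_{2i-1}\cup A_{2i}$ for every integer $1\le i\le \frac{k-1}{2}$. Then $m$ is a good $k$-layered number.
   Context: $\sigma(n)$ denotes the sum of the positive divisors of $n$. A positive integer $n$ is $k$-layered if the set of all positive divisors of $n$ can be partitioned into $k$ subsets $A_1,\dots,A_k$ having the same sum of elements; such a partition $\{A_1,\dots,A_k\}$ is called a $k$-layered partition for $n$. An even $k$-layered number $n$ is called a good $k$-layered number if $2^{\beta}n$ is $k$-layered for every positive integer $\beta$. *)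

(* Defs.v *)
From mathcomp Require Import all_boot.
From mathcomp Require Import finmap.

Set Implicit Arguments.
Unset Strict Implicit.
Unset Printing Implicit Defensive.

Definition sigma (n : nat) : nat := \sum_(d <- divisors n) d.

Definition divset (n : nat) : {fset nat} := [fset d in divisors n]%fset.

Definition fsum (A : {fset nat}) : nat := \sum_(d <- A) d.

(* The parts are A 1, ..., A k; values of A outside this range are ignored. *)
Definition layered_partition (k n : nat) (A : nat -> {fset nat}) : Prop :=
  [/\ forall i, 1 <= i <= k -> A i <> fset0,
      forall i j, 1 <= i <= k -> 1 <= j <= k -> i <> j ->
        [disjoint A i & A j]%fset,
      (\bigcup_(i <- iota 1 k) A i)%fset = divset n
    & forall i j, 1 <= i <= k -> 1 <= j <= k -> fsum (A i) = fsum (A j)].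

(* Positivity is required because divisors 0 is the empty sequence. *)
Definition layered (k n : nat) : Prop :=
  0 < n /\ exists A : nat -> {fset nat}, layered_partition k n A.

Definition good_layered (k n : nat) : Prop :=
  [/\ ~~ odd n, layered k n & forall b, 0 < b -> layered k (2 ^ b * n)].

(* Main.v *)
(** A partition is handled as a colouring of the divisors. Passing from
    [2 ^ a * n] to [2 ^ a.+1 * n] adds the divisors [2 ^ a.+1 * x], [x %| n], so
    with [s := sigma n / k] every part must grow by [2 ^ a.+1 * s]. For
    [x \in A' i], whose top multiple [2 ^ a * x] has colour [2 i - 1] or [2 i],
    move [2 ^ a * x] to the other part of the pair and put [2 ^ a.+1 * x] where
    [2 ^ a * x] was: both parts gain exactly [2 ^ a * x], in total
    [2 ^ a * (2 * s)]. The [x] outside all [A' i] sum to [s], and their multiples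
    [2 ^ a.+1 * x] all go to part [k]. The hypothesis on the pairs then holds one
    level higher, so the step can be iterated. *)

Require Import Defs.
From mathcomp Require Import all_boot.
From mathcomp Require Import finmap.
From mathcomp Require Import zify.

Set Implicit Arguments.
Unset Strict Implicit.
Unset Printing Implicit Defensive.

(** * Partitions into equal sums as colourings *)

(** A colouring makes disjointness and covering automatic; nonempty parts follow once [0 < S]. *)
Definition colour_sums (k N S : nat) (c : nat -> nat) : Prop :=
  (forall d, d %| N -> 1 <= c d <= k) /\
  (forall j, 1 <= j <= k -> \sum_(d <- divisors N | c d == j) d = S).

Lemma fsum_eq_mem (A : {fset nat}) (s : seq nat) :
  uniq s -> A =i s -> fsum A = \sum_(d <- s) d.
Proof. by move=> Us As; apply/perm_big/uniq_perm. Qed.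

Lemma in_divset (N d : nat) : 0 < N -> (d \in divset N) = (d %| N).
Proof. by move=> N0; rewrite /divset !inE -dvdn_divisors. Qed.

Lemma layered_of_colour_sums (k N S : nat) (c : nat -> nat) :
  0 < N -> 0 < S -> colour_sums k N S c -> layered k N.
Proof.
move=> N0 S0 [crange csum]; split=> //.
pose A j := [fset d in [seq d <- divisors N | c d == j]]%fset.
have inA j d : (d \in A j) = (d %| N) && (c d == j).
  by rewrite /A !inE mem_filter -dvdn_divisors // andbC.
have sumA j : 1 <= j <= k -> fsum (A j) = S.
  move=> /csum <-; rewrite -big_filter; apply: fsum_eq_mem.
    by rewrite filter_uniq // divisors_uniq.
  by move=> d; rewrite inA mem_filter -dvdn_divisors // andbC.
exists A; split.
- move=> i /sumA sumAi Ai0; move: S0.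
  by rewrite -sumAi Ai0 /fsum big_seq_fset0.
- move=> i j _ _ neq_ij; apply/fdisjointP => d; rewrite !inA.
  by case/andP=> -> /eqP ->; apply/eqP.
- apply/fsetP => d; rewrite in_divset //; apply/bigfcupP/idP.
    by case=> j _; rewrite inA => /andP[].
  move=> dN; exists (c d); last by rewrite inA dN eqxx.
  by have := crange d dN; rewrite mem_iota andbT; lia.
- by move=> i j /sumA -> /sumA ->.
Qed.

(** The last clause keeps the numbering of the parts, on which the pairing into [2 * i - 1] and
    [2 * i] depends. *)
Lemma colour_sums_of_partition (k N : nat) (A : nat -> {fset nat}) :
  0 < k -> 0 < N -> layered_partition k N A ->
  exists c S, [/\ 0 < S, colour_sums k N S c
    & forall d j, 1 <= j <= k -> d \in A j -> c d = j].
Proof.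
move=> k0 N0 [A_neq0 A_disj A_cover A_sum].
(* [find] counts from 0 while the parts start at 1; a [d] in no part gets the default [k.+1]. *)
pose c d := (find (fun j => d \in A j) (iota 1 k)).+1.
have cE d j : 1 <= j <= k -> d \in A j -> c d = j.
  move=> jk dj.
  have hasd : has (fun j => d \in A j) (iota 1 k).
    by apply/hasP; exists j => //; rewrite mem_iota; lia.
  have lt_find : c d <= k by move: hasd; rewrite has_find size_iota.
  have := nth_find 0 hasd; rewrite nth_iota // add1n -/(c d) => dc.
  apply: contraTeq dj => /eqP neq.
  have /fdisjointP : [disjoint A (c d) & A j]%fset by apply: A_disj.
  exact.
have subA j d : 1 <= j <= k -> d \in A j -> d %| N.
  move=> jk dj; rewrite -in_divset // -A_cover; apply/bigfcupP; exists j => //.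
  by rewrite mem_iota andbT; lia.
have inA d : d %| N -> exists2 j, 1 <= j <= k & d \in A j.
  rewrite -in_divset // -A_cover => /bigfcupP[j]; rewrite mem_iota andbT.
  by move=> jk dj; exists j => //; lia.
have k1 : 1 <= 1 <= k by [].
exists c, (fsum (A 1)); split=> //.
  have /fset0Pn[d d1] : A 1 != fset0 by apply/eqP/A_neq0.
  rewrite /fsum (big_rem d) //= addn_gt0; apply/orP; left.
  by apply: (dvdn_gt0 N0); apply: subA d1.
split=> [d /inA[j jk dj]|j jk]; first by rewrite (cE d j).
rewrite (A_sum 1 j) // -big_filter; apply/esym/fsum_eq_mem.
  by rewrite filter_uniq // divisors_uniq.
move=> d; rewrite mem_filter -dvdn_divisors //; apply/idP/andP.
  by move=> dj; rewrite (cE d j) // (subA j).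
by case=> /eqP <- /inA[i ik di]; rewrite (cE d i).
Qed.

(** * Divisors after one more factor 2 *)

(** The new divisors are those with exactly [a.+1] factors 2; the odd cofactor of such a divisor
    divides [n]. *)
Lemma divisors_double (n a : nat) : odd n ->
  perm_eq (divisors (2 ^ a.+1 * n))
          (divisors (2 ^ a * n) ++ [seq 2 ^ a.+1 * x | x <- divisors n]).
Proof.
move=> n_odd; have n0 : 0 < n by case: n n_odd.
have p0 b : 0 < 2 ^ b by rewrite expn_gt0.
have N0 b : 0 < 2 ^ b * n by rewrite muln_gt0 p0.
have inj : injective (muln (2 ^ a.+1)).
  by move=> x y /eqP; rewrite eqn_pmul2l // => /eqP.
apply: uniq_perm; first exact: divisors_uniq.
  rewrite cat_uniq !divisors_uniq (map_inj_uniq inj) divisors_uniq /= andbT.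
  apply/hasPn => _ /mapP[x _ ->]; rewrite /= -dvdn_divisors //.
  (* After cancelling [2 ^ a], the even number [2 * x] would divide the odd [n]. *)
  rewrite expnSr -mulnA dvdn_pmul2l //.
  by apply/negP => /dvdn_odd /(_ n_odd); rewrite oddM.
move=> d; rewrite mem_cat -!dvdn_divisors //; apply/idP/orP.
  move=> dN; have d0 := dvdn_gt0 (N0 _) dN.
  have [q q2 dE] := pfactor_coprime (isT : prime 2) d0.
  have q_n : q %| n.
    rewrite -(@Gauss_dvdr _ (2 ^ a.+1)).
      by apply: dvdn_trans dN; rewrite dE dvdn_mulr.
    by rewrite coprime_sym coprimeXl.
  have le_a : logn 2 d <= a.+1.
    rewrite -(@dvdn_Pexp2l 2) // -(@Gauss_dvdl _ _ n).
      by apply: dvdn_trans dN; rewrite {2}dE dvdn_mull.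
    by rewrite coprimeXl // coprime2n.
  move: le_a; rewrite leq_eqVlt => /orP[/eqP da|lt_a].
    right; apply/mapP; exists q; first by rewrite -dvdn_divisors.
    by rewrite {1}dE da mulnC.
  by left; rewrite dE mulnC dvdn_mul // dvdn_exp2l.
case=> [dN|/mapP[x]].
  by apply: (dvdn_trans dN); rewrite dvdn_mul // dvdn_exp2l.
by rewrite -dvdn_divisors // => xn ->; rewrite dvdn_pmul2l.
Qed.

(** * One recolouring step *)

(* [idx x] is the [i] with [x \in A' i], or [uphalf k] when there is none. *)
Definition recolour (k a : nat) (idx c : nat -> nat) (d : nat) : nat :=
  if 2 ^ a.+1 %| d then
    let x := d %/ 2 ^ a.+1 in if idx x < uphalf k then c (2 ^ a * x) else k
  else if (2 ^ a %| d) && (idx (d %/ 2 ^ a) < uphalf k) then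
    if odd (c d) then (c d).+1 else (c d).-1
  else c d.

Section Recolour.

Variables (k n a s : nat) (idx c : nat -> nat).
Hypotheses (k_odd : odd k) (n_odd : odd n) (a_gt0 : 0 < a).
Hypothesis idx_range : forall x, x %| n -> idx x <= uphalf k.
(** The elements outside all [A' i] sum to [s] only; doubling at [i == uphalf k] makes the formula
    uniform in [i]. *)
Hypothesis idx_sum : forall i, 1 <= i <= uphalf k ->
  (\sum_(x <- divisors n | idx x == i) x) * (i == uphalf k).+1 = 2 * s.
(** [uphalf y = i] encodes that [y] is [2 * i - 1] or [2 * i]. *)
Hypothesis c_top : forall x, x %| n -> idx x < uphalf k ->
  uphalf (c (2 ^ a * x)) = idx x.

Let n_gt0 : 0 < n. Proof. by case: (n) n_odd. Qed.
Let p_gt0 b : 0 < 2 ^ b. Proof. by rewrite expn_gt0. Qed.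
Let c' := recolour k a idx c.

Lemma recolour_top x :
  c' (2 ^ a.+1 * x) = if idx x < uphalf k then c (2 ^ a * x) else k.
Proof. by rewrite /c' /recolour dvdn_mulr // mulKn. Qed.

Lemma recolour_mid x : x %| n ->
  c' (2 ^ a * x) = let y := c (2 ^ a * x) in
    if idx x < uphalf k then if odd y then y.+1 else y.-1 else y.
Proof.
move=> xn; rewrite /c' /recolour expnSr dvdn_pmul2l // dvdn2.
by rewrite (dvdn_odd xn n_odd) /= dvdn_mulr // mulKn.
Qed.

(** As [n] is odd and [a] positive, such a [d] has fewer than [a] factors 2 and falls into the last
    branch of [recolour]. *)
Lemma recolour_low d : d %| 2 ^ a.-1 * n -> c' d = c d.
Proof.
move=> dN; have nd : ~~ (2 ^ a %| d).
  apply/negP => /dvdn_trans /(_ dN).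
  by rewrite -{1}(prednK a_gt0) expnSr dvdn_pmul2l // dvdn2 n_odd.
rewrite /c' /recolour (negPf nd) /=; case: ifP => // ad.
by rewrite (dvdn_trans _ ad) // in nd; apply: dvdn_exp2l.
Qed.

(** In units of [2 ^ a * x], a swap moves weight 1 and the new divisor brings weight 2 to the colour
    just left: both colours of the pair gain 1. An unpaired [x] gives 2 to [k], which, [k] being
    odd, is the only colour up to [k] with its [uphalf]. *)
Lemma recolour_weight x j : x %| n -> 1 <= j <= k ->
  (c' (2 ^ a * x) == j) + 2 * (c' (2 ^ a.+1 * x) == j) =
  (c (2 ^ a * x) == j) + (idx x == uphalf j) * (uphalf j == uphalf k).+1.
Proof.
move=> xn jk; rewrite recolour_top recolour_mid //=.
have := idx_range xn; have := @c_top _ xn.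
case: ltnP => [lt_i /(_ isT) cx _|ge_i _ le_i].
  by move: lt_i cx; case: ifP; lia.
lia.
Qed.

Lemma recolour_sums S : colour_sums k (2 ^ a * n) S c ->
  colour_sums k (2 ^ a.+1 * n) (S + 2 ^ a.+1 * s) c'.
Proof.
move=> [c_range c_sum].
(* Only the divisors [2 ^ a * x] can change colour, so they are separated from the lower ones. *)
have split_low F : \sum_(d <- divisors (2 ^ a * n)) F d =
    \sum_(d <- divisors (2 ^ a.-1 * n)) F d +
    \sum_(x <- divisors n) F (2 ^ a * x).
  have := divisors_double a.-1 n_odd; rewrite prednK // => low.
  by rewrite (perm_big _ low) big_cat big_map.
split=> [d dN|j jk].
  have N_gt0 b : 0 < 2 ^ b * n by rewrite muln_gt0 p_gt0.
  have : d \in divisors (2 ^ a.+1 * n) by rewrite -dvdn_divisors.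
  have := divisors_double a.-1 n_odd; rewrite prednK // => dbl.
  rewrite (perm_mem (divisors_double a n_odd)) mem_cat (perm_mem dbl) mem_cat.
  rewrite -!dvdn_divisors //.
  have k1 : 1 <= k by case: (k) k_odd.
  have rng x : x %| n -> 1 <= c (2 ^ a * x) <= k.
    by move=> xn; apply: c_range; rewrite dvdn_pmul2l.
  case/orP=> [/orP[dl|/mapP[x]]|/mapP[x]].
  - rewrite recolour_low //; apply: c_range.
    by apply: (dvdn_trans dl); rewrite dvdn_mul // dvdn_exp2l // leq_pred.
  - rewrite -dvdn_divisors // => xn ->; rewrite recolour_mid //=.
    have := rng x xn; case: (ltnP (idx x) (uphalf k)) => // ix.
    (* A swapped colour keeps its [uphalf], which is below [uphalf k], so it stays between 1 and
       [k]. *)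
    by have := c_top xn ix; case: ifP; lia.
  - rewrite -dvdn_divisors // => xn ->; rewrite recolour_top.
    by case: (ltnP (idx x)) => _; [apply: rng | rewrite k1 leqnn].
rewrite big_mkcond (perm_big _ (divisors_double a n_odd)) big_cat big_map /=.
rewrite -(c_sum j jk) [in RHS]big_mkcond !split_low -!addnA; congr (_ + _).
  apply: eq_big_seq => d; rewrite -dvdn_divisors ?muln_gt0 ?p_gt0 // => dl.
  by rewrite recolour_low.
(* The gain is spread over the divisors [x] of [n] through [idx_sum] at [uphalf j], so that both
   sides compare term by term. *)
have -> : 2 ^ a.+1 * s = \sum_(x <- divisors n)
    2 ^ a * x * ((idx x == uphalf j) * (uphalf j == uphalf k).+1).
  rewrite expnSr -mulnA -(@idx_sum (uphalf j)); last by lia.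
  rewrite big_mkcond big_distrl big_distrr /=; apply: eq_bigr => x _.
  by case: eqP => _; rewrite ?mul0n ?muln0 // mul1n mulnA.
rewrite -!big_split /=; apply: eq_big_seq => x; rewrite -dvdn_divisors // => xn.
have ifE (b : bool) y : (if b then y else 0) = y * b by case: b; lia.
rewrite !ifE -mulnDr -recolour_weight // mulnDr; congr (_ + _).
by rewrite expnSr; lia.
Qed.

Lemma recolour_uphalf x : x %| n -> idx x < uphalf k ->
  uphalf (c' (2 ^ a.+1 * x)) = idx x.
Proof. by move=> xn ix; rewrite recolour_top ix c_top. Qed.

End Recolour.

(** * Iteration from the given partition *)

Theorem theorem5p6 (k n : nat) (hk3 : 3 <= k) (hk : odd k) (hn : odd n)
    (hkn : k %| sigma n)
    (A' : nat -> {fset nat})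
    (hA'sub : forall i, 1 <= i <= (k - 1) %/ 2 -> (A' i `<=` divset n)%fset)
    (hA'disj : forall i j, 1 <= i <= (k - 1) %/ 2 -> 1 <= j <= (k - 1) %/ 2 ->
       i <> j -> [disjoint A' i & A' j]%fset)
    (hA'sum : forall i, 1 <= i <= (k - 1) %/ 2 ->
       fsum (A' i) = (2 * sigma n) %/ k)
    (alpha : nat) (halpha : 0 < alpha)
    (A'' : nat -> {fset nat})
    (hA'' : forall i, 1 <= i <= (k - 1) %/ 2 ->
       A'' i = [fset 2 ^ alpha * d | d in A' i]%fset)
    (m : nat) (hm : m = 2 ^ alpha * n)
    (A : nat -> {fset nat})
    (hA : layered_partition k m A)
    (hA''A : forall i, 1 <= i <= (k - 1) %/ 2 ->
       (A'' i `<=` A (2 * i - 1) `|` A (2 * i))%fset) :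
  good_layered k m.
Proof.
have n0 : 0 < n by case: (n) hn.
have p0 b : 0 < 2 ^ b by rewrite expn_gt0.
pose r := (k - 1) %/ 2; pose s := sigma n %/ k.
have sE : s * k = sigma n by rewrite divnK.
have rE : uphalf k = r.+1 by rewrite /r; lia.
have kE : k = 2 * r + 1 by rewrite /r; lia.
(* An [x] in no [A' i] gets the default [r.+1], which is [uphalf k]. *)
pose idx x := (find (fun i => x \in A' i) (iota 1 r)).+1.
have idx_le x : idx x <= r.+1.
  by rewrite /idx ltnS -{2}(size_iota 1 r) find_size.
have idx_lt x : idx x <= r -> x \in A' (idx x).
  move=> ix; have hasx : has (fun i => x \in A' i) (iota 1 r).
    by rewrite has_find size_iota.
  by have := nth_find 0 hasx; rewrite nth_iota.
have idxE x i : 1 <= i <= r -> x \in A' i -> idx x = i.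
  move=> ir xi; have hasx : has (fun i => x \in A' i) (iota 1 r).
    by apply/hasP; exists i => //; rewrite mem_iota; lia.
  have ix : idx x <= r by move: hasx; rewrite has_find size_iota.
  apply: contraTeq xi => /eqP neq.
  have /fdisjointP : [disjoint A' (idx x) & A' i]%fset by apply: hA'disj.
  by apply; apply: idx_lt.
have sumlt i : 1 <= i <= r -> \sum_(x <- divisors n | idx x == i) x = 2 * s.
  move=> ir; have -> : 2 * s = (2 * sigma n) %/ k by rewrite /s muln_divA.
  rewrite -(hA'sum i ir) -big_filter; apply/esym/fsum_eq_mem.
    by rewrite filter_uniq // divisors_uniq.
  move=> x; rewrite mem_filter -dvdn_divisors //; apply/idP/andP.
    move=> xi; rewrite (idxE x i) // eqxx; split=> //.
    by rewrite -in_divset //; apply: (fsubsetP (hA'sub i ir)).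
  by case=> /eqP ix _; rewrite -ix; apply: idx_lt; lia.
have sum_total : sigma n =
    \sum_(1 <= i < r.+2) \sum_(x <- divisors n | idx x == i) x.
  under eq_bigr do rewrite big_mkcond; rewrite exchange_big /=.
  apply: eq_bigr => x _; rewrite -big_mkcond /=.
  under eq_bigl do rewrite eq_sym; rewrite big_nat1_eq.
  by rewrite /= ltnS idx_le.
(* The first [r] classes take [2 * r * s] of the total [(2 * r + 1) * s]. *)
have sumr : \sum_(x <- divisors n | idx x == r.+1) x = s.
  move: sum_total; rewrite big_nat_recr //=.
  rewrite (eq_big_nat _ _ (F2 := fun => 2 * s)); last first.
    by move=> i ir; apply: sumlt; lia.
  by rewrite sum_nat_const_nat -sE kE; lia.
have idx_sum i : 1 <= i <= uphalf k ->
    (\sum_(x <- divisors n | idx x == i) x) * (i == uphalf k).+1 = 2 * s.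
  rewrite rE; case: eqP => [-> _|neq ir]; first by rewrite sumr mulnC.
  by rewrite sumlt ?muln1 //; lia.
have m0 : 0 < m by rewrite hm muln_gt0 p0.
(* The last clause is the invariant that feeds the next recolouring; starting at [alpha] keeps the
   exponent positive, as that step requires. *)
have colouring b : exists c S, [/\ 0 < S, colour_sums k (2 ^ (b + alpha) * n) S c
    & forall x, x %| n -> idx x < uphalf k ->
      uphalf (c (2 ^ (b + alpha) * x)) = idx x].
  elim: b => [|b [c [S [S0 cS ctop]]]].
    have k0 : 0 < k by lia.
    have [c [S [S0 cS cA]]] := colour_sums_of_partition k0 m0 hA.
    exists c, S; rewrite add0n -hm; split=> // x xn; rewrite rE ltnS => ix.
    have ir : 1 <= idx x <= r by rewrite ix.
    have : 2 ^ alpha * x \in A'' (idx x).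
      by rewrite hA'' //; apply: in_imfset; apply: idx_lt.
    move/(fsubsetP (hA''A _ ir)); rewrite in_fsetU.
    (* With [i] for [idx x], both [2 * i - 1] and [2 * i] have [uphalf] equal to [i] and lie between
       1 and [2 * r < k]. *)
    by case/orP=> /cA ->; lia.
  exists (recolour k (b + alpha) idx c), (S + 2 ^ (b + alpha).+1 * s).
  split; first by rewrite addn_gt0 S0.
  - apply: (recolour_sums hk hn) => //; first by rewrite addn_gt0 halpha orbT.
    by move=> x _; rewrite rE.
  - exact: recolour_uphalf.
split; first by rewrite hm oddM oddX /=; lia.
  by split=> //; exists A.
move=> b _; have [c [S [S0 cS _]]] := colouring b.
rewrite hm mulnA -expnD.
by apply: (layered_of_colour_sums _ S0 cS); rewrite muln_gt0 p0.
Qed.
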